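(* If $\mathcal{F}$ is a factorization of $\Delta^2$ in $B_3$ into two positive half-twists and one fourth power of a positive half-twist (in any order), then $\mathcal{F}$ is Hurwitz equivalent to the factorization $(\sigma_1^4,\sigma_1^{-1}\sigma_2\sigma_1,\sigma_2^{-1}\sigma_1\sigma_2)$ of $\Delta^2$.
   Context: $B_3=\langle\sigma_1,\sigma_2:\sigma_1\sigma_2\sigma_1=\sigma_2\sigma_1\sigma_2\rangle$ and $\Delta=\sigma_1\sigma_2\sigma_1$; $\Delta^2$ is central in $B_3$. A positive half-twist is a conjugate of $\sigma_1$ in $B_3$. A factorization of $g$ in a group $G$ is a tuple $(g_1,\dots,g_m)$ of elements of $G$ with $g=g_1\cdots g_m$. A Hurwitz move replaces adjacent factors $(g_j,g_{j+1})$ by $(g_jg_{j+1}g_j^{-1},g_j)$ or by $(g_{j+1},g_{j+1}^{-1}g_jg_{j+1})$. Two factorizations of a central element are Hurwitz equivalent if they are related by a finite sequence of Hurwitz moves and global conjugations $(g_1,\dots,g_m)\mapsto(hg_1h^{-1},\dots,hg_mh^{-1})$, $h\in G$. *)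

(* Defs.v *)
From HB Require Import structures.
From Stdlib Require Import Relation_Operators.
From mathcomp Require Import all_boot boolp.

Set Implicit Arguments.
Unset Strict Implicit.
Unset Printing Implicit Defensive.

Local Open Scope group_scope.
Local Open Scope quotient_scope.

Section Presentation.
Variable X : choiceType.

(* The letter (x, true) stands for x and (x, false) for its formal inverse. *)
Definition word := seq (X * bool).

Definition invl (l : X * bool) : X * bool := (l.1, ~~ l.2).
Definition invw (w : word) : word := rev (map invl w).

Variable rels : word -> word -> Prop.

Inductive word_cong : word -> word -> Prop :=
| WCrefl u : word_cong u u
| WCsym u v : word_cong u v -> word_cong v u
| WCtrans u v w : word_cong u v -> word_cong v w -> word_cong u w
| WCcat u u' v v' :
    word_cong u u' -> word_cong v v' -> word_cong (u ++ v) (u' ++ v')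
| WCcancel l : word_cong [:: l; invl l] [::]
| WCrel u v : rels u v -> word_cong u v.

Definition word_eqb (u v : word) : bool := `[< word_cong u v >].

Lemma word_eqb_refl : reflexive word_eqb.
Proof. by move=> u; apply/asboolP; exact: WCrefl. Qed.

Lemma word_eqb_sym : symmetric word_eqb.
Proof. by move=> u v; apply/asboolP/asboolP; exact: WCsym. Qed.

Lemma word_eqb_trans : transitive word_eqb.
Proof.
by move=> v u w /asboolP uv /asboolP vw; apply/asboolP; exact: WCtrans uv vw.
Qed.

Canonical word_equiv :=
  EquivRel word_eqb word_eqb_refl word_eqb_sym word_eqb_trans.

Definition presented := {eq_quot word_equiv}.
HB.instance Definition _ := Choice.on presented.

Definition wclass (w : word) : presented := \pi_presented w.

Lemma wclassP u v : wclass u = wclass v <-> word_cong u v.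
Proof.
by split=> [/eqP|uv]; [rewrite eqmodE => /asboolP | apply/eqP; rewrite eqmodE; apply/asboolP].
Qed.

Lemma wclassK (a : presented) : wclass (repr a) = a.
Proof. exact: reprK. Qed.

Definition pone : presented := wclass [::].
Definition pmul (a b : presented) : presented := wclass (repr a ++ repr b).
Definition pinv (a : presented) : presented := wclass (invw (repr a)).

Lemma repr_wclass w : word_cong (repr (wclass w)) w.
Proof. by apply/wclassP; rewrite wclassK. Qed.

Lemma pmulE u v : pmul (wclass u) (wclass v) = wclass (u ++ v).
Proof. by apply/wclassP; apply: WCcat; exact: repr_wclass. Qed.

Lemma invlK : involutive invl.
Proof. by case=> x b; rewrite /invl /= negbK. Qed.

Lemma invw_cat u v : invw (u ++ v) = invw v ++ invw u.
Proof. by rewrite /invw map_cat rev_cat. Qed.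

Lemma invwK : involutive invw.
Proof. by move=> u; rewrite /invw map_rev revK (mapK invlK). Qed.

Lemma cat_invw u : word_cong (u ++ invw u) [::].
Proof.
elim: u => [|l u IHu]; first exact: WCrefl.
rewrite -cat1s invw_cat -catA [u ++ _]catA.
apply: WCtrans (WCcancel l).
apply: (WCcat (WCrefl [:: l])).
rewrite -[in X in word_cong _ X](cat0s [:: invl l]).
by apply: WCcat => //; exact: WCrefl.
Qed.

Lemma invw_cong u v : word_cong u v -> word_cong (invw u) (invw v).
Proof.
move=> uv; have h1 : word_cong (invw u ++ v) [::].
  apply: WCtrans (_ : word_cong (invw u ++ u) _).
    by apply: WCcat; [exact: WCrefl | exact: WCsym].
  by have := cat_invw (invw u); rewrite invwK.
apply: WCtrans (_ : word_cong ((invw u ++ v) ++ invw v) _).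
  rewrite -catA -[in X in word_cong X _](cats0 (invw u)).
  by apply: WCcat; [exact: WCrefl | apply: WCsym; exact: cat_invw].
by rewrite -[in X in word_cong _ X](cat0s (invw v)); apply: WCcat => //; exact: WCrefl.
Qed.

Lemma pinvE u : pinv (wclass u) = wclass (invw u).
Proof. by apply/wclassP; apply: invw_cong; exact: repr_wclass. Qed.

Lemma pmulA : associative pmul.
Proof.
by move=> a b c; rewrite -(wclassK a) -(wclassK b) -(wclassK c) !pmulE catA.
Qed.

Lemma pmul1 : left_id pone pmul.
Proof. by move=> a; rewrite -(wclassK a) pmulE. Qed.

Lemma pmulr1 : right_id pone pmul.
Proof. by move=> a; rewrite -(wclassK a) pmulE cats0. Qed.

Lemma pmulV : right_inverse pone pinv pmul.
Proof.
move=> a; rewrite -(wclassK a) pinvE pmulE; apply/wclassP; exact: cat_invw.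
Qed.

Lemma pmulVl : left_inverse pone pinv pmul.
Proof.
move=> a; rewrite -(wclassK a) pinvE pmulE; apply/wclassP.
by rewrite -[X in _ ++ X]invwK; exact: cat_invw.
Qed.

HB.instance Definition _ :=
  isGroup.Build presented pmulA pmul1 pmulr1 pmulVl pmulV.

Definition pgen (x : X) : presented := wclass [:: (x, true)].

Lemma wclass_nil : wclass [::] = 1. Proof. by []. Qed.

Lemma wclass_cat u v : wclass (u ++ v) = wclass u * wclass v.
Proof. by rewrite -pmulE. Qed.

Lemma wclass_letter x b :
  wclass [:: (x, b)] = if b then pgen x else (pgen x)^-1.
Proof. by case: b => //; rewrite /pgen -[RHS]/(pinv _) pinvE. Qed.

Section Universal.
Variables (G : groupType) (f : X -> G).

Definition eval_word (w : word) : G :=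
  \prod_(l <- w) (if l.2 then f l.1 else (f l.1)^-1).

Hypothesis f_rels : forall u v, rels u v -> eval_word u = eval_word v.

Lemma eval_word_cat u v : eval_word (u ++ v) = eval_word u * eval_word v.
Proof. exact: big_cat. Qed.

Lemma eval_word_cong u v : word_cong u v -> eval_word u = eval_word v.
Proof.
elim=> {u v} // [u v w _ -> _ -> //|u u' v v' _ IHu _ IHv|[x b]].
  by rewrite !eval_word_cat IHu IHv.
by rewrite /eval_word !big_cons big_nil mulg1; case: b => /=; rewrite ?mulgV ?mulVg.
Qed.

Lemma presented_universal :
  exists phi : presented -> G,
    {morph phi : a b / a * b} /\ forall x, phi (pgen x) = f x.
Proof.
exists (fun a => eval_word (repr a)); split=> [a b|x].
  by rewrite -eval_word_cat; apply: eval_word_cong; exact: repr_wclass.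
rewrite (eval_word_cong (repr_wclass _)).
by rewrite /eval_word big_cons big_nil mulg1.
Qed.

End Universal.
End Presentation.

Section Factorizations.
Variable G : groupType.
Implicit Types (g h a b : G) (F s t : seq G).

Definition factorization g F := \prod_(x <- F) x = g.

Inductive hurwitz_move : seq G -> seq G -> Prop :=
| HurwitzL s a b t :
    hurwitz_move (s ++ [:: a, b & t]) (s ++ [:: a * b * a^-1, a & t])
| HurwitzR s a b t :
    hurwitz_move (s ++ [:: a, b & t]) (s ++ [:: b, b^-1 * a * b & t]).

Inductive hurwitz_step : seq G -> seq G -> Prop :=
| HurwitzMove F F' : hurwitz_move F F' -> hurwitz_step F F'
| HurwitzConj h F : hurwitz_step F [seq h * x * h^-1 | x <- F].

Definition hurwitz_equiv : seq G -> seq G -> Prop :=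
  clos_refl_trans (seq G) hurwitz_step.

Lemma hurwitz_step_sym F F' : hurwitz_step F F' -> hurwitz_step F' F.
Proof.
case=> {F F'} [_ _ []|] => [s a b t|s a b t|h F].
- apply: HurwitzMove; have := HurwitzR s (a * b * a^-1) a t.
  by rewrite !mulgA mulVg mul1g mulgVK.
- apply: HurwitzMove; have := HurwitzL s b (b^-1 * a * b) t.
  by rewrite !mulgA mulgV mul1g mulgK.
have := HurwitzConj h^-1 [seq h * x * h^-1 | x <- F]; rewrite -map_comp.
rewrite [X in hurwitz_step _ X -> _](_ : _ = F) // -[RHS]map_id.
by apply: eq_map => x /=; rewrite invgK !mulgA mulVg mul1g mulgVK.
Qed.

Lemma hurwitz_equiv_sym F F' : hurwitz_equiv F F' -> hurwitz_equiv F' F.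
Proof.
elim=> {F F'} [F F' /hurwitz_step_sym|F|F F' F'' _ h1 _ h2].
- exact: rt_step.
- exact: rt_refl.
exact: rt_trans h2 h1.
Qed.

End Factorizations.

Definition letter1 : 'I_2 * bool := (ord0, true).
Definition letter2 : 'I_2 * bool := (ord_max, true).

Definition braid_rel (u v : word 'I_2) : Prop :=
  u = [:: letter1; letter2; letter1] /\ v = [:: letter2; letter1; letter2].

Definition B3 : groupType := presented braid_rel.

Definition sigma1 : B3 := pgen braid_rel ord0.
Definition sigma2 : B3 := pgen braid_rel ord_max.
Definition Delta : B3 := sigma1 * sigma2 * sigma1.

Lemma braid_relation : sigma1 * sigma2 * sigma1 = sigma2 * sigma1 * sigma2.
Proof.
have E (i j k : 'I_2) : pgen braid_rel i * pgen braid_rel j * pgen braid_rel k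
    = wclass braid_rel [:: (i, true); (j, true); (k, true)].
  rewrite (wclass_cat _ [:: (i, true); (j, true)] [:: (k, true)]).
  by rewrite (wclass_cat _ [:: (i, true)] [:: (j, true)]).
by rewrite !E; apply: (proj2 (wclassP _ _ _)); apply: WCrel; split.
Qed.

Definition positive_half_twist (x : B3) : Prop :=
  exists h : B3, x = h * sigma1 * h^-1.

Lemma Delta2_central (x : B3) : Delta ^+ 2 * x = x * Delta ^+ 2.
Proof.
have D1 : Delta * sigma1 = sigma2 * Delta.
  by rewrite /Delta {1}braid_relation !mulgA.
have D2 : Delta * sigma2 = sigma1 * Delta.
  by rewrite /Delta [in RHS]braid_relation !mulgA.
have DD (a b : B3) : Delta * a = b * Delta -> Delta * b = a * Delta ->
    commute (Delta ^+ 2) a.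
  by move=> ab ba; rewrite /commute expgS expg1 -mulgA ab mulgA ba -mulgA.
have D2gen (i : 'I_2) : commute (Delta ^+ 2) (pgen braid_rel i).
  have [->|->] : i = ord0 \/ i = ord_max.
  - by case: i => [[|[|//]] ?]; [left | right]; apply: val_inj.
  - exact: DD D1 D2.
  exact: DD D2 D1.
rewrite -(wclassK x); elim: (repr x) => [|[i b] w IHw].
  by rewrite wclass_nil mulg1 mul1g.
rewrite -cat1s wclass_cat; apply: commuteM => //.
rewrite wclass_letter; case: b => //; exact: commuteV.
Qed.

(* Main.v *)
Require Import Defs.
From HB Require Import structures.
From mathcomp Require Import all_boot.
From Stdlib Require Import Relation_Operators.
From mathcomp Require Import order ssralg ssrnum ssrint zify ring.


(** B3 acts on Z^2 through SL2(Z): sigma1 and sigma2 act as the transvections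
    along (1, 0) and (0, 1), and Delta^2 acts as -1.  A half-twist
    h sigma1 h^-1 then acts as the transvection along the vector h (1, 0), and
    the proof rests on the fact that this vector, taken up to sign, determines
    the half-twist (half_twist_eq).  Equivalently, an h that fixes (1, 0) up
    to sign commutes with sigma1 (fixes_e1_commute).  This is a form of the
    statement that PSL2(Z) is B3 modulo its center, and it is proved by a
    version of the Euclidean algorithm: modulo the centralizer of sigma1 on
    the right and at most one factor Delta on the left, every braid is a
    product M of factors sigma1 and sigma2^-1 (decomposableP).  These two
    preserve the positive quadrant, so M moves (1, 0) off the coordinate axes
    unless M is a power of sigma1.

    Given a factorization as in the theorem, Hurwitz moves bring the fourth
    power to the front, and a global conjugation turns it into sigma1^4
    (fourth_power_front).  So let sigma1^4 b c = Delta^2, with b and c acting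
    as the transvections along v and w.  Evaluating both sides at w, which c
    fixes, gives two integer equations; with the primitivity of w they force
    w = (p, q) with q = 1 or q = -1 (last_twist_vector).  A power of sigma1
    carries w to (1, 1) or (-1, -1), and conjugating by it leaves sigma1^4
    unchanged.  Now w is, up to sign, the vector of sigma2^-1 sigma1 sigma2,
    so c is that half-twist, and b is determined by the product.  After the
    fourth power has been brought to the front, global conjugations alone thus
    suffice. *)

Import GRing.Theory.

Local Open Scope group_scope.

(** * Hurwitz equivalence *)

Lemma hurwitz_equiv_conj (G : groupType) (h : G) (F : seq G) :
  hurwitz_equiv F [seq h * x * h^-1 | x <- F].
Proof. by apply: rt_step; apply: HurwitzConj. Qed.

Lemma hurwitz_equiv_front (G : groupType) (y : G) (s t : seq G) :
  hurwitz_equiv (s ++ y :: t) (y :: [seq y^-1 * x * y | x <- s] ++ t).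
Proof.
elim/last_ind: s t => [|s x IHs] t; first exact: rt_refl.
rewrite map_rcons !cat_rcons; apply: rt_trans (IHs _).
by apply: rt_step; apply: HurwitzMove; apply: HurwitzR.
Qed.

Lemma prod_conj (G : groupType) (h : G) (F : seq G) :
  \prod_(x <- [seq h * x * h^-1 | x <- F]) x = h * (\prod_(x <- F) x) * h^-1.
Proof.
elim: F => [|x F IHF]; first by rewrite !big_nil mulg1 mulgV.
by rewrite /= !big_cons IHF !mulgA mulgVK.
Qed.

Lemma hurwitz_equiv_fact (G : groupType) (g : G) (F F' : seq G) :
  (forall h, g * h = h * g) -> hurwitz_equiv F F' ->
  factorization g F -> factorization g F'.
Proof.
move=> gC; elim=> {F F'} [F F' step|//|F F' F'' _ IH1 _ IH2 /IH1 /IH2 //].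
rewrite /factorization; case: step => {F F'} [_ _ []|] => [s a b t|s a b t|h F] gF.
- by rewrite -gF !big_cat !big_cons /= !mulgA mulgVK.
- by rewrite -gF !big_cat !big_cons /= !mulgA mulgK.
by rewrite prod_conj gF -gC mulgK.
Qed.

(** * The action of the braid group on integer vectors *)

Lemma B3_ind (P : B3 -> Prop) :
  P 1 ->
  (forall h, P h -> P (sigma1 * h)) -> (forall h, P h -> P (sigma1^-1 * h)) ->
  (forall h, P h -> P (sigma2 * h)) -> (forall h, P h -> P (sigma2^-1 * h)) ->
  forall h, P h.
Proof.
move=> P1 Ps1 Ps1V Ps2 Ps2V h; rewrite -(wclassK h).
elim: (repr h) => [|[i b] w IHw]; first by rewrite wclass_nil.
rewrite -cat1s wclass_cat wclass_letter.
have [->|->] : i = ord0 \/ i = ord_max.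
  by case: i => [[|[|//]] ?]; [left | right]; apply: val_inj.
- by case: b; [apply: Ps1 | apply: Ps1V].
by case: b; [apply: Ps2 | apply: Ps2V].
Qed.

(** The letters x1 and x2 act by the matrices (1 1; 0 1) and (1 0; -1 1) on
    column vectors. *)
Definition shear (l : 'I_2 * bool) (p : int * int) : int * int :=
  let e : int := if l.2 then 1%R else (-1)%R in
  if l.1 == ord0 then (p.1 + e * p.2, p.2)%R else (p.1, p.2 - e * p.1)%R.

Definition shear_word (w : word 'I_2) (p : int * int) : int * int :=
  foldr shear p w.

Lemma shear_word_cong u v :
  word_cong braid_rel u v -> shear_word u =1 shear_word v.
Proof.
elim=> {u v} [u|u v _ IH|u v w _ IH1 _ IH2|u u' v v' _ IHu _ IHv|[i b]|u v [-> ->]] p //.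
- by rewrite IH1.
- by rewrite /shear_word !foldr_cat -/(shear_word v p) IHv; apply: IHu.
- case: p => x y; rewrite /shear_word /shear /=.
  by case: eqP => _; case: b => /=; congr (_, _); ring.
case: p => x y; rewrite /shear_word /shear /=.
by congr (_, _); ring.
Qed.

Definition act (h : B3) : int * int -> int * int := shear_word (repr h).

Lemma act_wclass w : act (wclass braid_rel w) =1 shear_word w.
Proof. exact/shear_word_cong/repr_wclass. Qed.

Lemma act1 p : act 1 p = p.
Proof. exact: (act_wclass [::]). Qed.

Lemma actM g h p : act (g * h) p = act g (act h p).
Proof. by rewrite (act_wclass (repr g ++ repr h)) /shear_word foldr_cat. Qed.

Lemma actK h p : act h (act h^-1 p) = p.
Proof. by rewrite -actM mulgV act1. Qed.

Lemma act_sigma1 x y : act sigma1 (x, y) = (x + y, y)%R.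
Proof. by rewrite act_wclass /= /shear /= mul1r. Qed.

Lemma act_sigma2 x y : act sigma2 (x, y) = (x, y - x)%R.
Proof. by rewrite act_wclass /= /shear /= mul1r. Qed.

Lemma act_sigma1V x y : act sigma1^-1 (x, y) = (x - y, y)%R.
Proof.
rewrite -[in LHS](_ : act sigma1 (x - y, y)%R = (x, y)) -?actM ?mulVg ?act1 //.
by rewrite act_sigma1 subrK.
Qed.

Lemma act_sigma2V x y : act sigma2^-1 (x, y) = (x, y + x)%R.
Proof.
rewrite -[in LHS](_ : act sigma2 (x, y + x)%R = (x, y)) -?actM ?mulVg ?act1 //.
by rewrite act_sigma2 addrK.
Qed.

Lemma act_Delta x y : act Delta (x, y) = (y, - x)%R.
Proof. by rewrite !actM act_sigma1 act_sigma2 act_sigma1; congr (_, _); ring. Qed.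

(** Linearity and invariance of the symplectic form at once: each generator acts
    by row operations of determinant 1. *)
Lemma act_SL2 h : exists a b c d : int, (a * d - b * c = 1)%R /\
  forall x y, act h (x, y) = (a * x + b * y, c * x + d * y)%R.
Proof.
elim/B3_ind: h => [|h [a [b [c [d [D E]]]]]|h [a [b [c [d [D E]]]]]
                  |h [a [b [c [d [D E]]]]]|h [a [b [c [d [D E]]]]]].
- by exists 1%R, 0%R, 0%R, 1%R; split=> // x y; rewrite act1; congr (_, _); ring.
- exists (a + c)%R, (b + d)%R, c, d; split=> [|x y]; first by rewrite -D; ring.
  by rewrite actM E act_sigma1; congr (_, _); ring.
- exists (a - c)%R, (b - d)%R, c, d; split=> [|x y]; first by rewrite -D; ring.
  by rewrite actM E act_sigma1V; congr (_, _); ring.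
- exists a, b, (c - a)%R, (d - b)%R; split=> [|x y]; first by rewrite -D; ring.
  by rewrite actM E act_sigma2; congr (_, _); ring.
exists a, b, (c + a)%R, (d + b)%R; split=> [|x y]; first by rewrite -D; ring.
by rewrite actM E act_sigma2V; congr (_, _); ring.
Qed.

Definition e1 : int * int := (1, 0)%R.

Lemma actN h x y : act h (- x, - y)%R = (- (act h (x, y)).1, - (act h (x, y)).2)%R.
Proof.
by have [a [b [c [d [_ E]]]]] := act_SL2 h; rewrite !E /=; congr (_, _); ring.
Qed.

(** sigma1 is the transvection p |-> p + omega(e1, p) e1 for
    omega((a, b), (c, d)) = a d - b c, and the action preserves omega; hence the
    conjugate by h is the transvection along h e1. *)
Lemma act_twist h x y v1 v2 : act h e1 = (v1, v2) ->
  act (h * sigma1 * h^-1) (x, y) =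
  (x + (v1 * y - v2 * x) * v1, y + (v1 * y - v2 * x) * v2)%R.
Proof.
have [a [b [c [d [D E]]]]] := act_SL2 h.
rewrite /e1 E !mulr1 !mulr0 !addr0 => -[<- <-].
rewrite !actM; have := actK h (x, y); case: (act h^-1 (x, y)) => x' y'.
rewrite act_sigma1 !E => -[<- <-].
have -> : (a * (c * x' + d * y') - c * (a * x' + b * y') = y')%R.
  by rewrite -[RHS]mul1r -D; ring.
by congr (_, _); ring.
Qed.

(** * Braids fixing a vector up to sign commute with its half-twist *)

Definition fixes_e1 (h : B3) := act h e1 = e1 \/ act h e1 = (-1, 0)%R.

Lemma intM1 (a b : int) : (a * b = 1)%R -> a = 1%R \/ a = (-1)%R.
Proof.
by move=> /(congr1 absz)/eqP; rewrite abszM muln_eq1 => /andP[/eqP a1 _]; lia.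
Qed.

(** The eigenvectors of sigma1 are the multiples of e1, and h e1 is primitive. *)
Lemma commute_fixes_e1 h : commute sigma1 h -> fixes_e1 h.
Proof.
have [a [b [c [d [D E]]]]] := act_SL2 h => C.
have := congr1 (act^~ e1) C; rewrite /fixes_e1 /e1 !actM act_sigma1 !E act_sigma1.
rewrite !mulr1 !mulr0 !addr0 => -[/eqP]; rewrite -subr_eq0 addrAC subrr add0r.
move=> /eqP c0; move: D; rewrite c0 mulr0 subr0 => /intM1[] ->; [by left|by right].
Qed.

(** The submonoid generated by sigma1 and sigma2^-1, which act by the matrices
    (1 1; 0 1) and (1 0; 1 1): the two steps of the Euclidean algorithm. *)
Inductive positive : B3 -> Prop :=
| positive1 : positive 1
| positiveL M : positive M -> positive (sigma1 * M)
| positiveR M : positive M -> positive (sigma2^-1 * M).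

(** Up to sign, every primitive vector lies in the closed first quadrant or in its
    image by Delta; i tells which. *)
Definition decomposable (h : B3) : Prop :=
  exists (i : bool) (M k : B3),
    [/\ positive M, commute sigma1 k & h = Delta ^+ i * M * k].

Lemma Delta_sigma1 : Delta * sigma1 = sigma2 * Delta.
Proof. by rewrite /Delta {1}braid_relation !mulgA. Qed.

Lemma Delta_sigma2 : Delta * sigma2 = sigma1 * Delta.
Proof. by rewrite /Delta [in RHS]braid_relation !mulgA. Qed.

Lemma commuteDelta2 h : commute h (Delta ^+ 2).
Proof. by rewrite /commute Delta2_central. Qed.

Lemma decomposable_mulr h k :
  decomposable h -> commute sigma1 k -> decomposable (h * k).
Proof.
move=> [i [M [k' [PM Ck' ->]]]] Ck; exists i, M, (k' * k).
by split; rewrite ?mulgA //; apply: commuteM.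
Qed.

Lemma decomposable_Delta h : decomposable h -> decomposable (Delta * h).
Proof.
move=> [[] [M [k [PM Ck ->]]]]; last first.
  by exists true, M, k; split; rewrite // expg0 mul1g expg1 mulgA.
exists false, M, (Delta ^+ 2 * k); split=> //.
  by apply: commuteM => //; apply: commuteDelta2.
by rewrite expg0 expg1 mul1g (mulgA M) (commuteDelta2 M) expgS expg1 !mulgA.
Qed.

(** Delta^-1 is Delta times the central element Delta^-2, which the factor
    centralizing sigma1 absorbs. *)
Lemma decomposable_DeltaV h : decomposable h -> decomposable (Delta^-1 * h).
Proof.
move=> Dh; have -> : Delta^-1 * h = Delta * (h * (Delta ^+ 2)^-1).
  have C : commute (Delta ^+ 2)^-1 h.
    by apply/commute_sym/commuteV/commuteDelta2.
  apply: (mulgI Delta).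
  by rewrite mulVKg -C (mulgA Delta) -[Delta * Delta]/(Delta ^+ 2) mulVKg.
apply/decomposable_Delta/decomposable_mulr => //.
by apply/commuteV/commuteDelta2.
Qed.

Lemma sigma1V_commute : commute sigma1 sigma1^-1.
Proof. by apply: commuteV; exact: commute_refl. Qed.

(** sigma1^-1 cancels a leading sigma1, while
    sigma1^-1 sigma2^-1 = Delta^-1 sigma1. *)
Lemma decomposable_sigma1V M k :
  positive M -> commute sigma1 k -> decomposable (sigma1^-1 * M * k).
Proof.
move=> PM Ck; case: PM => [|M' PM'|M' PM'].
- exists false, 1, (sigma1^-1 * k); split; first exact: positive1.
    by apply: commuteM => //; exact: sigma1V_commute.
  by rewrite expg0 !mulg1 mul1g.
- by exists false, M', k; rewrite expg0 mul1g mulKg.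
have -> : sigma1^-1 * (sigma2^-1 * M') * k = Delta^-1 * (sigma1 * M' * k).
  by rewrite /Delta !invgM !mulgA mulgVK.
apply: decomposable_DeltaV; exists false, (sigma1 * M'), k.
by split; rewrite ?expg0 ?mul1g //; apply: positiveL.
Qed.

(** sigma2 cancels a leading sigma2^-1, while sigma2 sigma1 = Delta sigma2^-1. *)
Lemma decomposable_sigma2 M k :
  positive M -> commute sigma1 k -> decomposable (sigma2 * M * k).
Proof.
move=> PM Ck; case: PM => [|M' PM'|M' PM'].
- exists true, (sigma2^-1 * 1), (sigma1^-1 * k); split.
  + exact/positiveR/positive1.
  + by apply: commuteM => //; exact: sigma1V_commute.
  by rewrite expg1 !mulg1 /Delta braid_relation !mulgA mulgK mulgK.
- exists true, (sigma2^-1 * M'), k; split=> //; first exact: positiveR.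
  by rewrite expg1 /Delta braid_relation !mulgA mulgK.
by exists false, M', k; rewrite expg0 mul1g mulVKg.
Qed.

(** Decomposability survives left multiplication by each letter: the letter passes
    through Delta, which exchanges sigma1 and sigma2, and then meets M. *)
Lemma decomposableP h : decomposable h.
Proof.
have swap1 := Delta_sigma1; have swap2 := Delta_sigma2.
have swap1V : sigma1^-1 * Delta = Delta * sigma2^-1.
  by apply: (mulgI sigma1); rewrite mulVKg mulgA -swap2 mulgK.
have swap2V : sigma2^-1 * Delta = Delta * sigma1^-1.
  by apply: (mulgI sigma2); rewrite mulVKg mulgA -swap1 mulgK.
have posL M k : positive M -> commute sigma1 k -> decomposable (sigma1 * M * k).
  move=> PM Ck; exists false, (sigma1 * M), k.
  by rewrite expg0 mul1g; split=> //; apply: positiveL.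
have posR M k : positive M -> commute sigma1 k -> decomposable (sigma2^-1 * M * k).
  move=> PM Ck; exists false, (sigma2^-1 * M), k.
  by rewrite expg0 mul1g; split=> //; apply: positiveR.
have left_mul x x' : x * Delta = Delta * x' ->
    (forall M k, positive M -> commute sigma1 k -> decomposable (x * M * k)) ->
    (forall M k, positive M -> commute sigma1 k -> decomposable (x' * M * k)) ->
    forall g, decomposable g -> decomposable (x * g).
  move=> xD Dx Dx' _ [[] [M [k [PM Ck ->]]]].
    rewrite expg1 (mulgA x) (mulgA x) xD -!(mulgA Delta).
    by apply: decomposable_Delta; apply: Dx'.
  by rewrite expg0 mul1g mulgA; apply: Dx.
have D1V := decomposable_sigma1V; have D2 := decomposable_sigma2.
elim/B3_ind: h; last 4 first.
- by move=> h; apply: left_mul (esym swap2) posL D2 _.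
- by move=> h; apply: left_mul swap1V D1V posR _.
- by move=> h; apply: left_mul (esym swap1) D2 posL _.
- by move=> h; apply: left_mul swap2V posR D1V _.
exists false, 1, 1; split; [exact: positive1 | exact: commute1 |].
by rewrite expg0 !mulg1.
Qed.

(** A factor sigma2^-1 moves e1 into the open quadrant, which both factors
    preserve; without one, M is a power of sigma1. *)
Lemma positive_act M : positive M ->
  commute sigma1 M /\ act M e1 = e1 \/
  exists x y : int, [/\ act M e1 = (x, y), (0 < x)%R & (0 < y)%R].
Proof.
elim=> {M} [|M _ IH|M _ IH]; first by left; rewrite act1; split=> //; exact: commute1.
  case: IH => [[C E]|[x [y [E x0 y0]]]]; [left | right].
    by rewrite actM E act_sigma1; split=> //; apply: commuteM.
  by exists (x + y)%R, y; rewrite actM E act_sigma1; split=> //; lia.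
right; case: IH => [[C E]|[x [y [E x0 y0]]]].
  by exists 1%R, 1%R; rewrite actM E act_sigma2V.
by exists x, (y + x)%R; rewrite actM E act_sigma2V; split=> //; lia.
Qed.

Lemma fixes_e1_commute h : fixes_e1 h -> commute sigma1 h.
Proof.
have [i [M [k [PM Ck hE]]]] := decomposableP h.
have DM : fixes_e1 h -> fixes_e1 (Delta ^+ i * M).
  rewrite /fixes_e1 hE actM.
  have [->|->] // := commute_fixes_e1 _ Ck.
  have := actN (Delta ^+ i * M) 1 0; rewrite oppr0 -/e1 => ->.
  by case: (act _ e1) => x y [] [] /eqP xE /eqP yE; [right|left]; congr (_, _); lia.
move=> /DM; rewrite /fixes_e1 hE actM.
have [[CM ->]|[x [y [-> x0 y0]]]] := positive_act _ PM; last first.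
  by case: i {hE DM}; rewrite ?expg1 ?expg0 ?act1 ?act_Delta => -[] []; lia.
case: i {hE DM} => [|_]; first by rewrite expg1 act_Delta => -[] [].
by rewrite expg0 mul1g; apply: commuteM.
Qed.

(** A half-twist is determined by its vector up to sign: h^-1 g then fixes e1 up to
    sign, hence commutes with sigma1. *)
Lemma half_twist_eq g h :
  act g e1 = act h e1 \/ act g e1 = act h (-1, 0)%R ->
  g * sigma1 * g^-1 = h * sigma1 * h^-1.
Proof.
move=> E; have : commute sigma1 (h^-1 * g).
  apply: fixes_e1_commute; rewrite /fixes_e1 !actM.
  by case: E => ->; rewrite -!actM mulVg !act1; [left|right].
move=> /(congr1 (fun x => h * x * g^-1)); rewrite !mulgA mulgK mulgV mul1g.
by move=> <-.
Qed.

(** * Factorizations of the square of Delta *)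

Lemma act_sigma1_powers (n : int) : exists2 g : B3, commute g sigma1 &
  forall x y, act g (x, y) = (x + n * y, y)%R.
Proof.
case: n => n.
  exists (sigma1 ^+ n); first by apply: commute_sym; apply: commuteX; exact: commute_refl.
  elim: n => [|n IHn] x y; first by rewrite expg0 act1 mul0r addr0.
  by rewrite expgS actM IHn act_sigma1; congr (_, _); lia.
exists (sigma1^-1 ^+ n.+1).
  by apply: commute_sym; apply: commuteX; exact: sigma1V_commute.
elim: n => [|n IHn] x y; first by rewrite expg1 act_sigma1V; congr (_, _); lia.
by rewrite expgS actM IHn act_sigma1V; congr (_, _); lia.
Qed.

Lemma act_Delta2 x y : act (Delta ^+ 2) (x, y) = (- x, - y)%R.
Proof. by rewrite expgS expg1 actM !act_Delta. Qed.

Lemma act_sigma1_4 x y : act (sigma1 ^+ 4) (x, y) = (x + 4 * y, y)%R.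
Proof. by rewrite !expgS expg0 mulg1 !actM !act_sigma1; congr (_, _); ring. Qed.

(** Evaluate the product at the vector w = (p, q) of the last half-twist, which
    that half-twist fixes.  With v = (r, s) the vector of the other one and
    k = omega(v, w), this reads k v = (4 q - 2 p, - 2 q).  Pairing with w gives
    k^2 = 4 q^2, so q divides p, and primitivity makes q a unit. *)
Lemma last_twist_vector g h :
  sigma1 ^+ 4 * (g * sigma1 * g^-1) * (h * sigma1 * h^-1) = Delta ^+ 2 ->
  exists p q : int, act h e1 = (p, q) /\ (q = 1 \/ q = -1)%R.
Proof.
move=> E; have [p [d1 [q [d2 [D Eh]]]]] := act_SL2 h.
have hE : act h e1 = (p, q) by rewrite Eh; congr (_, _); ring.
exists p, q; split=> //.
case gE: (act g e1) => [r s].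
have := congr1 (act^~ (p, q)) E.
rewrite (actM _ (h * _ * _)) (actM _ (g * _ * _)) (act_twist _ _ _ _ _ hE).
rewrite (act_twist _ _ _ _ _ gE) act_sigma1_4 act_Delta2.
have -> : (p * q - q * p = 0)%R by ring.
rewrite !mul0r !addr0; set k := (r * q - s * p)%R => -[Ep Eq].
have kr : (k * r = 4 * q - 2 * p)%R by lia.
have ks : (k * s = - (2 * q))%R by lia.
have k2 : (k * k = 2 * q * (2 * q))%R.
  rewrite {2}/k mulrBr !mulrA kr ks; ring.
have /orP[/eqP kq|/eqP kq] : (k == 2 * q)%R || (k == - (2 * q))%R.
- by rewrite -eqf_sqr !expr2 k2.
- have pq : p = (q * (2 - r))%R by rewrite kq in kr; lia.
  have /intM1 // : (q * ((2 - r) * d2 - d1) = 1)%R by rewrite -[RHS]D pq; ring.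
have pq : p = (q * (2 + r))%R by rewrite kq in kr; lia.
have /intM1 // : (q * ((2 + r) * d2 - d1) = 1)%R by rewrite -[RHS]D pq; ring.
Qed.

(** A Hurwitz move carries the fourth power leftwards unchanged and replaces the
    half-twist that it passes by a conjugate, again a half-twist; a global
    conjugation then straightens the fourth power to sigma1^4. *)
Lemma fourth_power_front F :
  factorization (Delta ^+ 2) F ->
  (exists a b c : B3, [/\ positive_half_twist a, positive_half_twist b,
     positive_half_twist c & perm_eq F [:: a ^+ 4; b; c]]) ->
  exists g h : B3, let F' :=
      [:: sigma1 ^+ 4; g * sigma1 * g^-1; h * sigma1 * h^-1] in
    hurwitz_equiv F F' /\ factorization (Delta ^+ 2) F'.
Proof.
move=> F_fact [a [b [c [[f aE] b_ht c_ht FE]]]].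
have twist_conj y x : positive_half_twist x -> positive_half_twist (y^-1 * x * y).
  by move=> [k ->]; exists (y^-1 * k); rewrite invgM invgK !mulgA.
have aF : a ^+ 4 \in F by rewrite (perm_mem FE) mem_head.
case/splitPr: aF FE F_fact => s t; rewrite perm_catC perm_cons perm_catC.
move=> stE F_fact; set y := a ^+ 4 in stE F_fact *.
have ht x : x \in s ++ t -> positive_half_twist x.
  by rewrite (perm_mem stE) !inE => /orP[] /eqP ->.
have := hurwitz_equiv_front _ y s t.
set r := _ ++ t => FF'.
have r_size : size r = 2.
  by rewrite size_cat size_map -size_cat (perm_size stE).
have r_ht x : x \in r -> positive_half_twist x.
  rewrite mem_cat => /orP[/mapP[x' sx' ->]|tx].
    by apply/twist_conj/ht; rewrite mem_cat sx'.
  by apply: ht; rewrite mem_cat tx orbT.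
move: r r_size FF' r_ht => [|b' [|c' [|//]]] // _ FF' r_ht.
have b'_ht : positive_half_twist b' by apply: r_ht; rewrite mem_head.
have c'_ht : positive_half_twist c' by apply: r_ht; rewrite !inE eqxx orbT.
have [g gE] := twist_conj f _ b'_ht; have [h hE] := twist_conj f _ c'_ht.
exists g, h => F''.
have yE : f^-1 * y * f = sigma1 ^+ 4.
  by rewrite /y aE !expgS expg0 !mulg1 !mulgA mulVg mul1g !mulgVK.
have FF'' : hurwitz_equiv (s ++ y :: t) F''.
  apply: rt_trans FF' _; have := hurwitz_equiv_conj _ f^-1 [:: y; b'; c'].
  by rewrite /= invgK yE gE hE.
split=> //; apply: hurwitz_equiv_fact FF'' F_fact; exact: Delta2_central.
Qed.

Theorem theorem4p50 (F : seq B3)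
    (F_fact : factorization (Delta ^+ 2) F)
    (F_type : exists a b c : B3,
       [/\ positive_half_twist a, positive_half_twist b,
           positive_half_twist c & perm_eq F [:: a ^+ 4; b; c]]) :
  let F0 : seq B3 :=
    [:: sigma1 ^+ 4; sigma1^-1 * sigma2 * sigma1; sigma2^-1 * sigma1 * sigma2] in
  factorization (Delta ^+ 2) F0 /\ hurwitz_equiv F F0.
Proof.
move=> F0.
have F0_prod :
    sigma1 ^+ 4 * (sigma1^-1 * sigma2 * sigma1) * (sigma2^-1 * sigma1 * sigma2)
    = Delta ^+ 2.
  (* Both sides are sigma1^2 (Delta^2) sigma1^-2, once the last factor is written
     sigma1 sigma2 sigma1^-1. *)
  have cE : sigma2^-1 * sigma1 * sigma2 = sigma1 * sigma2 * sigma1^-1.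
    apply: (mulgI sigma2); apply: (mulIg sigma1).
    by rewrite !mulgA mulgV mul1g mulgVK braid_relation.
  have D2E : Delta ^+ 2 = sigma1 * sigma1 * Delta ^+ 2 * sigma1^-1 * sigma1^-1.
    by rewrite -(Delta2_central (sigma1 * sigma1)) mulgA !mulgK.
  by rewrite cE D2E /Delta !expgS !expg0 !mulg1 !mulgA mulgK mulgK.
have F0_fact : factorization (Delta ^+ 2) F0.
  by rewrite /factorization !big_cons big_nil /= mulg1 mulgA F0_prod.
split=> //.
have [g [h [FF' F'_fact]]] := fourth_power_front _ F_fact F_type.
have F'_prod : sigma1 ^+ 4 * (g * sigma1 * g^-1) * (h * sigma1 * h^-1) = Delta ^+ 2.
  by move: F'_fact; rewrite /factorization !big_cons big_nil /= mulg1 mulgA.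
have [p [q [hE q1]]] := last_twist_vector _ _ F'_prod.
(* As q^2 = 1, adding (1 - p q) q to p gives q, so z h e1 = (q, q). *)
have [z zC zE] := act_sigma1_powers (1 - p * q)%R.
have zhE : (z * h) * sigma1 * (z * h)^-1 = sigma2^-1 * sigma1 * sigma2.
  rewrite -{2}[sigma2]invgK; apply: half_twist_eq.
  rewrite actM hE zE !act_sigma2V.
  by case: q1 => ->; [left | right]; congr (_, _); ring.
have z4 : z * sigma1 ^+ 4 * z^-1 = sigma1 ^+ 4.
  by rewrite [z * _](commuteX 4 zC) mulgK.
apply: rt_trans FF' _.
have := hurwitz_equiv_conj _ z
  [:: sigma1 ^+ 4; g * sigma1 * g^-1; h * sigma1 * h^-1].
rewrite /= z4.
have -> : z * (h * sigma1 * h^-1) * z^-1 = sigma2^-1 * sigma1 * sigma2.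
  by rewrite -zhE invgM !mulgA.
(* The other two factors agree, and so do the products. *)
have -> // : z * (g * sigma1 * g^-1) * z^-1 = sigma1^-1 * sigma2 * sigma1.
apply: (mulgI (sigma1 ^+ 4)); apply: (mulIg (sigma2^-1 * sigma1 * sigma2)).
have -> : sigma1 ^+ 4 * (z * (g * sigma1 * g^-1) * z^-1) *
    (sigma2^-1 * sigma1 * sigma2) = z * Delta ^+ 2 * z^-1.
  rewrite -{1}z4 -zhE -F'_prod; move: (sigma1 ^+ 4) => y.
  by rewrite invgM !mulgA !mulgVK.
by rewrite F0_prod -Delta2_central mulgK.
Qed.
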